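(* Let $0<p\le 1$ and let $\mathcal{M}$ be an infinite $p$-metric space. Then $\mathcal{F}_{p}(\mathcal{M})$ contains a (closed linear) subspace isomorphic to $\ell_{p}$.
   Context: Let $0<p\le 1$. A $p$-metric on a set $\mathcal{M}$ is a symmetric map $d\colon\mathcal{M}\times\mathcal{M}\to[0,\infty)$ with $d(x,y)=0$ iff $x=y$ and $d^p(x,y)\le d^p(x,z)+d^p(z,y)$ for all $x,y,z$. A $p$-Banach space is a complete real vector space with a $p$-norm, i.e. a quasi-norm with $\|x+y\|^p\le\|x\|^p+\|y\|^p$. For a $p$-metric space $\mathcal{M}$ with base point $0$, the Lipschitz free $p$-space $\mathcal{F}_p(\mathcal{M})$ is the $p$-Banach space, unique up to linear isometry, with an isometric embedding $\delta_{\mathcal{M}}\colon\mathcal{M}\to\mathcal{F}_p(\mathcal{M})$, $\delta_{\mathcal{M}}(0)=0$, such that for every $p$-Banach space $X$ and every Lipschitz map $f\colon\mathcal{M}\to X$ with $f(0)=0$ there is a unique bounded linear map $T_f\colon\mathcal{F}_p(\mathcal{M})\to X$ with $T_f\circ\delta_{\mathcal{M}}=f$, and $\|T_f\|=\mathrm{Lip}(f)$. The linear span of $\delta_{\mathcal{M}}(\mathcal{M})$ is dense in $\mathcal{F}_p(\mathcal{M})$. Changing the base point yields a linearly isometric space. ''Isomorphic'' means linearly isomorphic with continuous inverse. $\ell_p$ carries its usual $p$-norm $(\sum_n|a_n|^p)^{1/p}$. *)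

(* Defs.v *)
From HB Require Import structures.
From mathcomp Require Import all_boot all_order all_algebra.
From mathcomp Require Import all_classical all_reals all_analysis.

Set Implicit Arguments.
Unset Strict Implicit.
Unset Printing Implicit Defensive.

Import Order.TTheory GRing.Theory Num.Theory.
Import numFieldNormedType.Exports.

Local Open Scope classical_set_scope.
Local Open Scope ring_scope.

Definition is_pmetric (R : realType) (p : R) (M : Type) (d : M -> M -> R) :=
  [/\ forall x y, 0 <= d x y,
      forall x y, d x y = d y x,
      forall x y, d x y = 0 <-> x = y
    & forall x y z, d x y `^ p <= d x z `^ p + d z y `^ p].

(* Spaces are equipped with the library uniform structure: [entourage_] of the
   balls of the quasi-norm generates the uniformity even though these balls need
   not satisfy the triangle inequality when p < 1. *)
HB.mixin Record PreUniformLmodule_isPNormed (R : realType) (p : R) V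
    & PreUniformLmodule R V := {
  pnorm : V -> R ;
  pnorm_ge0 : forall x, 0 <= pnorm x ;
  pnorm0_eq0 : forall x, pnorm x = 0 -> x = 0 ;
  pnormZ : forall (a : R) (x : V), pnorm (a *: x) = `|a| * pnorm x ;
  pnormD : forall x y : V, pnorm (x + y) `^ p <= pnorm x `^ p + pnorm y `^ p ;
  entourage_pnormE : @entourage V = entourage_ (ball_ pnorm)
}.

#[short(type="pNormedType")]
HB.structure Definition PNormed (R : realType) (p : R) :=
  {V of PreUniformLmodule R V & PreUniformLmodule_isPNormed R p V}.

(* [Uniform_isComplete] is not used because it requires a pointed type, which
   the library does not join with algebraic structures below normed ones. *)
HB.mixin Record PNormed_isPBanach (R : realType) (p : R) V
    & PNormed R p V := {
  pcauchy_cvg : forall G : set_system V,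
    ProperFilter G -> cauchy G -> exists l : V, G --> l
}.

#[short(type="pBanachType")]
HB.structure Definition PBanach (R : realType) (p : R) :=
  {V of PNormed R p V & PNormed_isPBanach R p V}.

HB.factory Record Lmodule_isPNormed (R : realType) (p : R) V
    & GRing.Lmodule R V := {
  p_gt0 : 0 < p ;
  pnorm : V -> R ;
  pnorm_ge0 : forall x, 0 <= pnorm x ;
  pnorm0_eq0 : forall x, pnorm x = 0 -> x = 0 ;
  pnormZ : forall (a : R) (x : V), pnorm (a *: x) = `|a| * pnorm x ;
  pnormD : forall x y : V, pnorm (x + y) `^ p <= pnorm x `^ p + pnorm y `^ p
}.

HB.builders Context R p V & Lmodule_isPNormed R p V.

Definition pent : set_system (V * V) := entourage_ (ball_ pnorm).

Let pnormB x y : pnorm (x - y) = pnorm (y - x).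
Proof. by rewrite -opprB -scaleN1r pnormZ normrN1 mul1r. Qed.

Let pent_filter : Filter pent.
Proof.
apply: filter_from_filter; first by exists 1 => /=.
move=> e1 e2 /= e10 e20; exists (Num.min e1 e2); first by rewrite /= lt_min e10.
by move=> xy; rewrite /ball_/= lt_min => /andP[].
Qed.

Let pent_diagonal A : pent A -> diagonal `<=` A.
Proof.
move=> [e /= e0 eA] xy xyE; apply: eA; rewrite /ball_/= xyE subrr.
by rewrite -(scale0r (0 : V)) pnormZ normr0 mul0r.
Qed.

Let pent_inv A : pent A -> pent A^-1%relation.
Proof.
by move=> [e e0 eA]; exists e => // xy; rewrite /ball_/= => xye; apply: eA;
  rewrite /ball_/= pnormB.
Qed.

Let pent_split A : pent A -> exists2 B, pent B & (B \; B)%relation `<=` A.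
Proof.
move=> [e /= e0 eA]; pose r := (e `^ p / 2) `^ p^-1.
have rp : r `^ p = e `^ p / 2.
  by rewrite /r -powRrM mulVf ?gt_eqF ?p_gt0// powRr1// divr_ge0// powR_ge0.
exists [set xy | ball_ pnorm xy.1 r xy.2].
  by exists r => //=; rewrite powR_gt0// divr_gt0// powR_gt0.
move=> xy [z /= xz zy]; apply: eA; rewrite /ball_/= ltNge; apply/negP => exy.
have plt u : pnorm u < r -> pnorm u `^ p < e `^ p / 2.
  move=> ur; rewrite -rp; apply: gt0_ltr_powR => //; first exact: p_gt0.
  - by rewrite nnegrE pnorm_ge0.
  - by rewrite nnegrE powR_ge0.
have : e `^ p <= pnorm (xy.1 - xy.2) `^ p.
  by apply: ge0_ler_powR => //; rewrite ?ltW ?p_gt0// nnegrE ?pnorm_ge0// ltW.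
apply/negP; rewrite -ltNge -(subrK z xy.1) -addrA.
apply: le_lt_trans (pnormD _ _) _.
by rewrite [ltRHS]splitr; apply: ltrD; exact: plt.
Qed.

HB.instance Definition _ := @isUniform.Build V
  pent pent_filter pent_diagonal pent_inv pent_split.

HB.instance Definition _ := @PreUniformLmodule_isPNormed.Build R p V
  pnorm pnorm_ge0 pnorm0_eq0 pnormZ pnormD erefl.

HB.end.

Definition lipschitz_pmap (R : realType) (p : R) (M : Type) (d : M -> M -> R)
    (X : pNormedType p) (f : M -> X) :=
  exists L : R, forall x y, pnorm (f x - f y) <= L * d x y.

(* [sup] is 0 on the empty set and on unbounded sets: the next definition is the
   usual constant only for Lipschitz maps, and likewise [opnorm] for bounded
   ones, which are the only cases in which they are used. *)
Definition lip_const (R : realType) (p : R) (M : Type) (d : M -> M -> R)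
    (X : pNormedType p) (f : M -> X) : R :=
  sup [set pnorm (f xy.1 - f xy.2) / d xy.1 xy.2 | xy in [set xy | xy.1 <> xy.2]].

Definition bounded_pmap (R : realType) (p : R) (E X : pNormedType p)
    (T : E -> X) :=
  exists C : R, forall x, pnorm (T x) <= C * pnorm x.

Definition opnorm (R : realType) (p : R) (E X : pNormedType p)
    (T : E -> X) : R :=
  sup [set pnorm (T x) | x in [set x : E | pnorm x <= 1]].

Definition is_free_pspace (R : realType) (p : R) (M : Type) (d : M -> M -> R)
    (x0 : M) (F : pBanachType p) (delta : M -> F) :=
  [/\ forall x y, pnorm (delta x - delta y) = d x y,
      delta x0 = 0
    & forall (X : pBanachType p) (f : M -> X),
        f x0 = 0 -> lipschitz_pmap d f ->
        exists T : {linear F -> X},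
          [/\ bounded_pmap T, T \o delta =1 f, opnorm T = lip_const d f
            & forall T' : {linear F -> X},
                bounded_pmap T' -> T' \o delta =1 f -> T' =1 T]].

Section ell_p.
Context (R : realType) (p : R).

Definition ellp_terms (a : nat -> R^o) : R^nat := fun n => `|a n| `^ p.

(* The proof argument makes the closure properties below available as instances. *)
Definition ellp_pred of (0 < p <= 1) : {pred nat -> R^o} :=
  [pred a | `[< cvgn (series (ellp_terms a)) >]].

Context (hp : 0 < p <= 1).

Let p_gt0 : 0 < p. Proof. by case/andP: hp. Qed.
Let p_neq0 : p != 0. Proof. by rewrite gt_eqF. Qed.

Let powR_subadd (u v : R) : 0 <= u -> 0 <= v ->
  (u + v) `^ p <= u `^ p + v `^ p.
Proof.
move=> u0 v0; have [s0|s0] := eqVneq (u + v) 0.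
  by rewrite s0 powR0// addr_ge0// powR_ge0.
have {}s0 : 0 < u + v by rewrite lt_neqAle eq_sym s0 addr_ge0.
have H w : 0 <= w -> w <= u + v -> w / (u + v) <= w `^ p / (u + v) `^ p.
  move=> w0 ws.
  have E : (w / (u + v)) `^ p * (u + v) `^ p = w `^ p.
    by rewrite -powRM ?divr_ge0// ?ltW// divfK// gt_eqF.
  rewrite -E mulfK ?gt_eqF ?powR_gt0//.
  have [->|wn0] := eqVneq w 0; first by rewrite mul0r powR0.
  apply: ger1_powR; last by case/andP: hp.
  by rewrite divr_gt0//= ?ler_pdivrMr ?mul1r// lt_neqAle eq_sym wn0.
have := lerD (H u u0 _) (H v v0 _); rewrite lerDl lerDr -!mulrDl divff ?gt_eqF//.
by move=> /(_ v0 u0); rewrite ler_pdivlMr ?mul1r ?powR_gt0.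
Qed.

Let ellp_termsD a b n : ellp_terms (a + b) n <= (ellp_terms a + ellp_terms b) n.
Proof.
rewrite /ellp_terms; apply: le_trans (powR_subadd (normr_ge0 _) (normr_ge0 _)).
by apply: (ge0_ler_powR (ltW p_gt0));
  rewrite ?nnegrE ?addr_ge0//; exact: (ler_normD (a n) (b n)).
Qed.

Let ellp_termsZ c a : ellp_terms (c *: a) = (`|c| `^ p) *: ellp_terms a.
Proof. by apply/funext => n; rewrite /ellp_terms/= normrM powRM. Qed.

Let ellp_terms_ge0 a n : 0 <= ellp_terms a n. Proof. exact: powR_ge0. Qed.

Let ellp_is_cvgD a b : cvgn (series (ellp_terms a)) ->
  cvgn (series (ellp_terms b)) -> cvgn (series (ellp_terms (a + b))).
Proof.
move=> ca cb; apply: series_le_cvg (is_cvg_seriesD ca cb) => n.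
- exact: ellp_terms_ge0.
- by rewrite addr_ge0// ellp_terms_ge0.
- exact: ellp_termsD.
Qed.

Let ellp_submod_closed : submod_closed (ellp_pred hp).
Proof.
split.
  apply/asboolP; rewrite -(scale0r 0) ellp_termsZ normr0 powR0// scale0r.
  rewrite (_ : series 0 = cst 0); first exact: is_cvg_cst.
  by apply/funext => n; rewrite /series/= big1.
move=> c a b /asboolP ca /asboolP cb; apply/asboolP/ellp_is_cvgD => //.
by rewrite ellp_termsZ; exact: is_cvg_seriesZ.
Qed.

HB.instance Definition _ :=
  GRing.isSubmodClosed.Build R (nat -> R^o) (ellp_pred hp) ellp_submod_closed.

Record ellp := EllP {
  ellp_seq :> nat -> R^o ;
  ellp_seqP : ellp_seq \in ellp_pred hp
}.

HB.instance Definition _ := [isSub for ellp_seq].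
HB.instance Definition _ := [Choice of ellp by <:].
HB.instance Definition _ := [SubChoice_isSubLmodule of ellp by <:].

Definition ellp_norm (a : ellp) : R := (limn (series (ellp_terms a))) `^ p^-1.

Let ellp_cvg (a : ellp) : cvgn (series (ellp_terms a)).
Proof. exact/asboolP/(ellp_seqP a). Qed.

Let ellp_term_le (a : ellp) n : ellp_terms a n <= limn (series (ellp_terms a)).
Proof.
have nd : nondecreasing_seq (series (ellp_terms a)).
  by apply: nondecreasing_series => i _ _; exact: ellp_terms_ge0.
apply: le_trans (nondecreasing_cvgn_le nd (@ellp_cvg a) n.+1).
rewrite /series/= big_nat_recr//= lerDr.
by apply: sumr_ge0 => i _; exact: ellp_terms_ge0.
Qed.

Let ellp_lim_ge0 (a : ellp) : 0 <= limn (series (ellp_terms a)).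
Proof. exact: le_trans (ellp_terms_ge0 a 0) (ellp_term_le a 0). Qed.

Let ellp_norm_powR (a : ellp) : ellp_norm a `^ p = limn (series (ellp_terms a)).
Proof. by rewrite /ellp_norm -powRrM mulVf// powRr1. Qed.

Let ellp_norm_ge0 (a : ellp) : 0 <= ellp_norm a.
Proof. exact: powR_ge0. Qed.

Let ellp_norm0_eq0 (a : ellp) : ellp_norm a = 0 -> a = 0.
Proof.
move=> a0; apply/val_inj/funext => n /=.
have := ellp_term_le a n; rewrite -ellp_norm_powR a0 powR0// => an.
have : ellp_terms a n = 0 by apply/eqP; rewrite eq_le an ellp_terms_ge0.
by move/powR_eq0_eq0/normr0_eq0.
Qed.

Let ellp_normZ (c : R) (a : ellp) : ellp_norm (c *: a) = `|c| * ellp_norm a.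
Proof.
rewrite /ellp_norm/= ellp_termsZ lim_seriesZ; last exact: ellp_cvg.
by rewrite powRM ?powR_ge0// -powRrM mulfV// powRr1.
Qed.

Let ellp_normD (a b : ellp) :
  ellp_norm (a + b) `^ p <= ellp_norm a `^ p + ellp_norm b `^ p.
Proof.
have ca := @ellp_cvg a; have cb := @ellp_cvg b.
have cab : cvgn (series (ellp_terms (ellp_seq a + ellp_seq b))).
  exact: ellp_is_cvgD.
rewrite [X in X <= _]ellp_norm_powR [X in _ <= X + _]ellp_norm_powR.
rewrite [X in _ <= _ + X]ellp_norm_powR -(lim_seriesD ca cb).
have -> : ellp_seq (a + b) = ellp_seq a + ellp_seq b by [].
apply: (lim_series_le cab (is_cvg_seriesD ca cb)) => n.
exact: ellp_termsD.
Qed.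

HB.instance Definition _ := @Lmodule_isPNormed.Build R p ellp
  p_gt0 ellp_norm ellp_norm_ge0 ellp_norm0_eq0 ellp_normZ ellp_normD.

End ell_p.

(* The first two conditions make S, restricted to Y, the inverse of T : E -> Y;
   its values outside Y are irrelevant. *)
Definition isomorphic_onto (R : realType) (p : R) (E F : pNormedType p)
    (Y : set F) :=
  exists (T : {linear E -> F}) (S : F -> E),
    [/\ range T = Y, cancel T S, continuous T & {within Y, continuous S}].

Definition contains_isomorphic_copy (R : realType) (p : R)
    (E F : pNormedType p) :=
  exists Y : set F,
    [/\ submod_closed (mem Y), closed Y & isomorphic_onto E Y].

(* Main.v *)
From HB Require Import structures.
Require Import Defs.
From mathcomp Require Import all_boot all_order all_algebra.
From mathcomp Require Import all_classical all_reals all_analysis.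
From mathcomp Require Import zify lra.

Set Implicit Arguments.
Unset Strict Implicit.
Unset Printing Implicit Defensive.

Import Order.TTheory GRing.Theory Num.Theory.
Import numFieldNormedType.Exports.

Local Open Scope classical_set_scope.
Local Open Scope ring_scope.

(** Write rho for the metric d `^ p and say that the modulus of a vector is the
    p-th power of its p-norm; the modulus is subadditive.  The copy of ell_p is
    spanned by normalized molecules
      u_n = (delta (x_n) - delta (z_n)) / d (x_n) (z_n),
    and all that is needed is a choice of pairs for which the modulus of
    sum_n b_n u_n dominates a constant times sum_n |b_n|^p; the reverse
    inequality is subadditivity.  A lower bound in the free space comes from
    its universal property, that is from a Lipschitz map f of M into some
    p-Banach space X for which the vectors f (x_n) - f (z_n) behave like
    disjointly supported functions.

    Such an f exists as soon as there are radii r_n, comparable to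
    rho (x_n) (z_n), for which the open rho-balls of centre x_n and radius r_n
    do not overlap (r_n + r_m <= rho (x_n) (x_m)) and contain no z_m.  Indeed,
    in L_p(N x [0, oo)) let f (w) be the indicator of {n} x [0, h], where n is
    the ball that contains w and h = r_n - rho w (x_n), or 0 if w lies in no
    ball.  Then the modulus of f v - f w is the measure of a symmetric
    difference and is at most rho v w; and f (x_n) - f (z_n) is the indicator of
    {n} x [0, r_n].  For p < 1 the target must be like L_p in that its continuous
    functionals do not separate points: if rho is the usual distance on an
    interval, then every Lipschitz map from M to the reals is constant, and so
    is every Lipschitz map to ell_p.

    The balls are found by [exists_bump_system].  Let t be a positive function
    on the range of a sequence y such that rho (y_n) (y_m) is comparable to the
    larger of t (y_n) and t (y_m); then pairing the terms 2n and 2n+1 works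
    ([bump_system_scales]).  If M is unbounded, t is the distance to a base
    point and y runs to infinity geometrically; if M contains a bounded
    separated sequence, t is constant; otherwise M is totally bounded, contains
    a Cauchy sequence, and t is the distance to its limit in the completion.

    Instead of L_p of a measure, the target is a reduced product: bounded
    sequences of functions on finer and finer grids, modulo the sequences whose
    mean modulus tends to 0.  Lengths of intervals become limits of frequencies
    of grid points, and completeness is a diagonal argument
    ([reduced_diagonal]).

    With the two-sided estimate, a |-> sum_n a_n u_n is an isomorphism of ell_p
    onto its range, which is closed because ell_p is complete
    ([ellp_complete], [isomorphic_copy_of_bounds]). *)

(** * Powers with exponent p, and p-normed spaces *)

(** With s = u + v, both u / s and v / s lie in [0, 1], where w <= w `^ p. *)
Lemma powR_subadd (R : realType) (p u v : R) : 0 < p <= 1 -> 0 <= u -> 0 <= v ->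
  (u + v) `^ p <= u `^ p + v `^ p.
Proof.
move=> /andP[p0 p1] u0 v0.
have [/eqP|s0] := eqVneq (u + v) 0.
  by rewrite paddr_eq0// => /andP[/eqP -> /eqP ->]; rewrite addr0 lerDl powR_ge0.
have {}s0 : 0 < u + v by rewrite lt0r s0 addr_ge0.
have scaled w : 0 <= w <= u + v -> w / (u + v) * (u + v) `^ p <= w `^ p.
  move=> /andP[w0 ws]; have [->|wn0] := eqVneq w 0.
    by rewrite !mul0r powR_ge0.
  have -> : w `^ p = (w / (u + v)) `^ p * (u + v) `^ p.
    by rewrite -powRM ?divr_ge0// ?ltW// divfK// gt_eqF.
  rewrite ler_wpM2r ?powR_ge0// ger1_powR//.
  by rewrite ler_pdivrMr// mul1r ws divr_gt0// lt0r wn0.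
have := lerD (scaled u _) (scaled v _).
by rewrite u0 v0 lerDl lerDr u0 v0 -!mulrDl divff ?gt_eqF// mul1r; apply.
Qed.

Lemma powR_cancel (R : realType) (p x : R) : 0 < p -> 0 <= x -> (x `^ p) `^ p^-1 = x.
Proof. by move=> p0 x0; rewrite -powRrM mulfV ?gt_eqF// powRr1. Qed.

Lemma powR_cancelV (R : realType) (p x : R) : 0 < p -> 0 <= x -> (x `^ p^-1) `^ p = x.
Proof. by move=> p0 x0; rewrite -powRrM mulVf ?gt_eqF// powRr1. Qed.

Lemma ler_powR_mono (R : realType) (p x y : R) : 0 < p -> 0 <= x -> 0 <= y ->
  (x `^ p <= y `^ p) = (x <= y).
Proof.
move=> p0 x0 y0; apply/idP/idP => [xy|]; last exact/ge0_ler_powR/y0/x0/ltW.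
by rewrite leNgt; apply: contraTN xy => yx; rewrite -ltNge gt0_ltr_powR.
Qed.

Lemma ltr_powR_mono (R : realType) (p x y : R) : 0 < p -> 0 <= x -> 0 <= y ->
  (x `^ p < y `^ p) = (x < y).
Proof. by move=> p0 x0 y0; rewrite !ltNge ler_powR_mono. Qed.

(** The p-th power of the p-norm: unlike the p-norm it is subadditive, so it
    serves as the distance in all estimates. *)
Definition pmod (R : realType) (p : R) (V : pNormedType p) (v : V) : R :=
  pnorm v `^ p.

Section pNormed_theory.
Context (R : realType) (p : R) (p0 : 0 < p) (V : pNormedType p).
Implicit Types (v w : V) (e : R).

Lemma pmod_ge0 v : 0 <= pmod v. Proof. exact: powR_ge0. Qed.

Lemma pnorm0 : pnorm (0 : V) = 0.
Proof. by rewrite -(scale0r 0) pnormZ normr0 mul0r. Qed.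

Lemma pmod0 : pmod (0 : V) = 0.
Proof. by rewrite /pmod pnorm0 powR0 ?gt_eqF. Qed.

Lemma pmod_eq0 v : pmod v = 0 -> v = 0.
Proof. by move=> /powR_eq0_eq0/pnorm0_eq0. Qed.

Lemma pmodD v w : pmod (v + w) <= pmod v + pmod w.
Proof. exact: pnormD. Qed.

Lemma pmodZ (a : R) v : pmod (a *: v) = `|a| `^ p * pmod v.
Proof. by rewrite /pmod pnormZ powRM ?pnorm_ge0. Qed.

Lemma pmodN v : pmod (- v) = pmod v.
Proof. by rewrite -scaleN1r pmodZ normrN1 powR1 mul1r. Qed.

Lemma pmodBC v w : pmod (v - w) = pmod (w - v).
Proof. by rewrite -opprB pmodN. Qed.

Lemma pmod_dist_le v w z : pmod (v - w) <= pmod (v - z) + pmod (z - w).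
Proof. by apply: le_trans (pmodD _ _); rewrite addrA subrK. Qed.

Lemma pmod_sum I (s : seq I) (P : pred I) (F : I -> V) :
  pmod (\sum_(i <- s | P i) F i) <= \sum_(i <- s | P i) pmod (F i).
Proof.
elim/big_rec2: _ => [|i x v _ vx]; first by rewrite pmod0.
by apply: le_trans (pmodD _ _) _; rewrite lerD2l.
Qed.

Lemma entourage_pmod (A : set (V * V)) :
  entourage A <->
  exists2 e, 0 < e & forall v w, pmod (v - w) < e -> A (v, w).
Proof.
rewrite entourage_pnormE; split=> [[e /= e0 eA]|[e e0 eA]].
  exists (e `^ p); first exact: powR_gt0.
  by move=> v w; rewrite ltr_powR_mono ?pnorm_ge0 ?ltW// => vw; exact: eA.
exists (e `^ p^-1) => /=; first exact: powR_gt0.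
move=> [v w] /= vw; apply: eA; rewrite /pmod -[ltRHS](powR_cancelV p0) ?ltW//.
by rewrite ltr_powR_mono ?pnorm_ge0 ?powR_ge0.
Qed.

Lemma nbhs_pmod v (A : set V) :
  nbhs v A <-> exists2 e, 0 < e & forall w, pmod (v - w) < e -> A w.
Proof.
rewrite -nbhs_entourageE; split=> [[B /entourage_pmod[e e0 eB] BA]|[e e0 eA]].
  by exists e => // w vw; apply/BA/xsectionP/eB.
exists [set vw | pmod (vw.1 - vw.2) < e]; first by apply/entourage_pmod; exists e.
by move=> w /xsectionP; exact: eA.
Qed.

Lemma cvg_pmod (G : set_system V) v : Filter G ->
  (forall e, 0 < e -> G [set w | pmod (v - w) < e]) -> G --> v.
Proof. by move=> FG Gv A /nbhs_pmod[e e0 eA]; apply: filterS (Gv e e0). Qed.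

Lemma cauchy_pmod (G : set_system V) : ProperFilter G -> cauchy G ->
  forall e, 0 < e -> exists v, G [set w | pmod (v - w) < e].
Proof.
move=> PG cG e e0.
have [|[P Q] [/= GP GQ] PQ] := cG [set vw | pmod (vw.1 - vw.2) < e].
  by apply/entourage_pmod; exists e.
have [v [Pv Qv]] := filter_ex (filterI GP GQ).
by exists v; apply: filterS GQ => w Qw; exact: (PQ (v, w)).
Qed.

End pNormed_theory.

(** * Balls that do not overlap in an infinite metric space *)

Lemma real_cauchy_cvg (R : realType) (u : nat -> R) :
  (forall e, 0 < e -> exists N, forall j, (N <= j)%N -> `|u N - u j| < e) ->
  cvgn u.
Proof.
move=> u_cauchy; apply: R_complete; apply: cauchy_exP => e e0.
by have [N uN] := u_cauchy e e0; exists (u N); exists N.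
Qed.

(** Dependent choice with memory: each term is chosen in view of all the
    previous ones. *)
Lemma greedy_sequence (T : Type) (t0 : T) (Q : T -> Prop) (S : T -> T -> Prop) :
  (forall n (v : nat -> T), (forall i, (i < n)%N -> Q (v i)) ->
    exists x, Q x /\ forall i, (i < n)%N -> S (v i) x) ->
  exists u : nat -> T,
    (forall n, Q (u n)) /\ forall m n, (m < n)%N -> S (u m) (u n).
Proof.
move=> step.
have /choice[f fP] (a : nat * (nat -> T)) : exists x,
    (forall i, (i < a.1)%N -> Q (a.2 i)) ->
    Q x /\ forall i, (i < a.1)%N -> S (a.2 i) x.
  have [Qa|nQa] := pselect (forall i, (i < a.1)%N -> Q (a.2 i)).
    by have [x xP] := step _ _ Qa; exists x.
  by exists t0.
(* [w n] carries the first n terms of the sequence; its other values are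
   arbitrary. *)
pose w := fix w n : nat -> T :=
  if n is m.+1 then fun i => if (i < m)%N then w m i else f (m, w m) else fun=> t0.
pose u n := f (n, w n).
have wE n i : (i < n)%N -> w n i = u i.
  elim: n => // n IHn; rewrite ltnS leq_eqVlt => /predU1P[->|i_n] /=.
    by rewrite ltnn.
  by rewrite i_n IHn.
have Qu n : Q (u n).
  elim/ltn_ind: n => n IHn; apply: (fP (n, w n) _).1 => i /= i_n.
  by rewrite wE//; exact: IHn.
exists u; split=> // m n mn.
by rewrite -(wE _ _ mn); apply: (fP (n, w n) _).2 => //= i i_n; rewrite wE.
Qed.

Section bump_system.
Context (R : realType) (M : Type) (rho : M -> M -> R).
Hypothesis rho_ge0 : forall x y, 0 <= rho x y.
Hypothesis rhoC : forall x y, rho x y = rho y x.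
Hypothesis rho_eq0 : forall x y, rho x y = 0 <-> x = y.
Hypothesis rho_triangle : forall x y z, rho x y <= rho x z + rho z y.

(** Disjoint balls of centre x n and radius r n avoiding every z m, with x n and
    z n at a distance of the order of the radius. *)
Definition bump_system (x z : nat -> M) (r : nat -> R) (c : R) :=
  [/\ 0 < c, forall n, 0 < r n, forall n, c * rho (x n) (z n) <= r n,
      forall n m, n != m -> r n + r m <= rho (x n) (x m)
    & forall n m, r n <= rho (x n) (z m)].

(** The number t n is the scale of y n.  In the pair y (2n), y (2n+1) the point
    of larger scale is the centre: its distance to its partner is then at most
    C times its own scale, while its distance to all other points is at least c
    times both scales involved, which leaves room for radii c/2 times the
    scale. *)
Lemma bump_system_scales (y : nat -> M) (t : nat -> R) (c C : R) :
  0 < c -> 0 < C -> (forall n, 0 < t n) ->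
  (forall n m, n != m -> c * t n <= rho (y n) (y m)) ->
  (forall n m, t m <= t n -> rho (y n) (y m) <= C * t n) ->
  exists x z r c', bump_system x z r c'.
Proof.
move=> c0 C0 t0 lower upper.
pose big n := if t n.*2.+1 <= t n.*2 then n.*2 else n.*2.+1.
pose small n := if t n.*2.+1 <= t n.*2 then n.*2.+1 else n.*2.
have t_small n : t (small n) <= t (big n).
  by rewrite /small /big; case: ifPn => //; rewrite -ltNge => /ltW.
have half_big n : (big n)./2 = n.
  by rewrite /big; case: ifP; rewrite /= ?uphalf_double ?doubleK.
have half_small n : (small n)./2 = n.
  by rewrite /small; case: ifP; rewrite /= ?uphalf_double ?doubleK.
have big_small n m : big n != small m.
  apply/eqP => nm; have nEm : n = m by rewrite -(half_big n) nm half_small.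
  move: nm; rewrite -{}nEm /big /small; case: ifP => _ /eqP.
    by rewrite ltn_eqF.
  by rewrite gtn_eqF.
have half_le n : c / 2 * t (big n) <= c * t (big n).
  by rewrite ler_wpM2r ?(ltW (t0 _))// ler_pdivrMr// ler_peMr ?ltW// ltrDl.
exists (y \o big), (y \o small), (fun n => c / 2 * t (big n)), (c / 2 / C).
split=> [|n|n|n m nm|n m] /=.
- by rewrite !divr_gt0.
- by rewrite mulr_gt0 ?divr_gt0.
- by rewrite -mulrA ler_pM2l ?divr_gt0// mulrC ler_pdivrMr// mulrC upper.
- have {}nm : big n != big m by apply: contra_neq nm => nm; rewrite -(half_big n) nm.
  have := lerD (lower _ _ nm) (lower (big m) (big n) _); rewrite eq_sym nm => /(_ isT).
  rewrite [X in _ <= _ + X]rhoC -mulr2n -mulrDr -[X in _ <= X]mulr_natr.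
  by rewrite -ler_pdivrMr// -mulrDr mulrAC.
- exact: le_trans (half_le n) (lower _ _ (big_small n m)).
Qed.

(** The two inequalities on t hold for the distance to a point of the completion.
    When the distances to this point grow or decay geometrically, the triangle
    inequality compares the distance of two terms with the larger of them. *)
Lemma bump_system_lacunary (t : M -> R) (y : nat -> M) :
  (forall a b, t a <= t b + rho a b) -> (forall a b, rho a b <= t a + t b) ->
  (forall n, 0 < t (y n)) ->
  (forall n m, n != m -> 2 * t (y n) <= t (y m) \/ 2 * t (y m) <= t (y n)) ->
  exists x z r c, bump_system x z r c.
Proof.
move=> t_lip t_le t0 lac.
apply: (@bump_system_scales y (t \o y) 2^-1 2) => //= [n m nm|n m mn].
  have := t_lip (y n) (y m); have := t_lip (y m) (y n); rewrite [rho (y m) _]rhoC.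
  have := t0 n; have := t0 m; rewrite mulrC ler_pdivrMr// mulrC.
  by case: (lac n m nm); lra.
by have := t_le (y n) (y m); lra.
Qed.

(** Far away points can be chosen one after the other, each at least twice as
    far from z as the previous ones. *)
Lemma bump_system_unbounded (z : M) :
  (forall D, exists x, D < rho x z) -> exists x z r c, bump_system x z r c.
Proof.
move=> unbounded.
have [|y [y0 y_grows]] := @greedy_sequence M z (fun x => 0 < rho x z)
    (fun x x' => 2 * rho x z <= rho x' z).
  move=> n v _; have [x xP] := unbounded (\sum_(i < n) 2 * rho (v i) z).
  (* The sum is a convenient upper bound for all the required distances. *)
  have sum_ge0 (P : pred 'I_n) : 0 <= \sum_(i < n | P i) 2 * rho (v i) z.
    by apply: sumr_ge0 => i _; rewrite mulr_ge0.
  exists x; split=> [|i i_n]; first exact: le_lt_trans xP.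
  apply/ltW/(le_lt_trans _ xP); rewrite (bigD1 (Ordinal i_n))//= lerDl.
  exact: sum_ge0.
apply: (@bump_system_lacunary (rho^~ z) y) => //.
- by move=> a b; rewrite addrC.
- by move=> a b; rewrite [rho b z]rhoC.
- by move=> n m; rewrite neq_ltn => /orP[/y_grows|/y_grows]; [left|right].
Qed.

Lemma bump_system_separated (y : nat -> M) (e D : R) : 0 < e ->
  (forall n m, n != m -> e <= rho (y n) (y m)) ->
  (forall n m, rho (y n) (y m) <= D) ->
  exists x z r c, bump_system x z r c.
Proof.
move=> e0 sep bnd.
apply: (@bump_system_scales y (fun=> 1) e D) => //.
- exact: lt_le_trans (lt_le_trans e0 (sep 0 1 _)) (bnd _ _).
- by move=> n m nm; rewrite mulr1 sep.
- by move=> n m _; rewrite mulr1.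
Qed.

(** The sets B k shrink to a point of the completion, and t is the distance to
    that point.  As B k is infinite it has two distinct points, and t cannot
    vanish at both, so t takes arbitrarily small positive values. *)
Lemma bump_system_nested (c : nat -> M) (B : nat -> set M) :
  (forall k, infinite_set (B k)) -> (forall k, B k.+1 `<=` B k) ->
  (forall k, B k (c k)) ->
  (forall k x y, B k x -> B k y -> rho x y <= k.+1%:R^-1) ->
  exists x z r c, bump_system x z r c.
Proof.
move=> B_inf B_dec Bc B_small.
have B_dec_le k j : (k <= j)%N -> B j `<=` B k.
  elim: j => [|j IHj]; first by rewrite leqn0 => /eqP ->.
  by rewrite leq_eqVlt => /predU1P[->//|/IHj jk]; exact: subset_trans (B_dec j) jk.
have c_dist x y z : `|rho x y - rho x z| <= rho y z.
  have := rho_triangle x y z; have := rho_triangle x z y; rewrite [rho z y]rhoC.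
  by rewrite ler_norml; lra.
have cvg_dist x : cvgn (fun k => rho x (c k)).
  apply: real_cauchy_cvg => e e0; have [k] := ltr_add_invr e0; rewrite add0r => ke.
  exists k => j kj; apply: le_lt_trans (c_dist _ _ _) _; apply: le_lt_trans ke.
  by apply: B_small => //; exact: B_dec_le (Bc j).
pose t x := limn (fun k => rho x (c k)).
have t_lip x y : t x <= t y + rho x y.
  apply: (ler_cvg_to (cvg_dist x) (cvgD (cvg_dist y) (cvg_cst (rho x y)))).
  by apply: nearW => k; have := rho_triangle x (c k) y; rewrite addrC.
have t_le x y : rho x y <= t x + t y.
  apply: (ler_cvg_to (cvg_cst (rho x y)) (cvgD (cvg_dist x) (cvg_dist y))).
  by apply: nearW => k; have := rho_triangle x y (c k); rewrite [rho (c k) y]rhoC.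
have t_small k x : B k x -> t x <= k.+1%:R^-1.
  move=> Bx; apply: limr_le (cvg_dist x) _; exists k => // j /= kj.
  by apply: B_small => //; exact: B_dec_le (Bc j).
have [|y [y0 y_decays]] := @greedy_sequence M (c 0) (fun x => 0 < t x)
    (fun x x' => 2 * t x' <= t x).
  move=> n v v0.
  have [e e0 ev] : exists2 e, 0 < e & forall i, (i < n)%N -> e <= t (v i).
    elim: n v0 => [|n IHn] v0; first by exists 1.
    have [|e e0 ev] := IHn; first by move=> i i_n; rewrite v0// ltnW.
    exists (Num.min e (t (v n))); first by rewrite lt_min e0 v0.
    by move=> i; rewrite ltnS leq_eqVlt ge_min => /predU1P[->|/ev ->//]; rewrite lexx orbT.
  have [k] := ltr_add_invr (divr_gt0 e0 (ltr0Sn _ 1)); rewrite add0r => ke.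
  have [a Ba] := infinite_setN0 (B_inf k).
  have [b [Bb /= ba]] := infinite_setN0 (infinite_setD (B_inf k) (finite_set1 a)).
  have rho_ab : 0 < rho a b.
    by rewrite lt0r rho_ge0 andbT; apply/eqP => /rho_eq0/esym.
  have [x Bx tx0] : exists2 x, B k x & 0 < t x.
    have [ta|ta] := ltP 0 (t a); first by exists a.
    by exists b => //; have := t_le a b; lra.
  exists x; split=> // i /ev; have := t_small k x Bx.
  by move: ke; rewrite ltr_pdivlMr//; move: (_^-1) => h; lra.
apply: (@bump_system_lacunary t y) => // n m.
by rewrite neq_ltn => /orP[/y_decays|/y_decays]; [right|left].
Qed.

(** The trichotomy: M is unbounded, or bounded with an infinite e-separated
    sequence for some e > 0, or, in the remaining case, every infinite subset has
    infinite subsets of arbitrarily small diameter, which are then nested. *)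
Theorem exists_bump_system : infinite_set [set: M] ->
  exists x z r c, bump_system x z r c.
Proof.
move=> M_inf; have [a0 _] := infinite_setN0 M_inf.
have [unbounded|/existsNP[D /forallNP a0D]] :=
  pselect (forall D, exists x, D < rho x a0); first exact: bump_system_unbounded unbounded.
have bounded x y : rho x y <= D + D.
  have le z : rho z a0 <= D by rewrite leNgt; apply/negP.
  by rewrite (le_trans (rho_triangle x y a0))// lerD// rhoC.
have [[e [y [e0 y_sep]]]|no_sep] := pselect (exists e (y : nat -> M), 0 < e /\
    forall n m, n != m -> e <= rho (y n) (y m)).
  exact: bump_system_separated e0 y_sep (fun n m => bounded _ _).
have small_subset (B : set M) (e : R) : infinite_set B -> 0 < e ->
    exists B', [/\ infinite_set B', B' `<=` B & forall x y, B' x -> B' y -> rho x y <= e].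
  move=> B_inf e0; have e20 : 0 < e / 2 by rewrite divr_gt0.
  have [x x_inf] : exists x, infinite_set (B `&` [set y | rho x y < e / 2]).
    (* If all balls of radius e/2 met B in finite sets, points of B outside the
       balls around the previous choices would form a separated sequence. *)
    apply: contrapT => /forallNP B_fin; apply: no_sep; exists (e / 2).
    have [b0 _] := infinite_setN0 B_inf.
    have [|y [_ y_sep]] := @greedy_sequence M b0 B (fun x x' => e / 2 <= rho x x').
      move=> n v _.
      have fin : finite_set (\bigcup_(i in `I_n) (B `&` [set y | rho (v i) y < e / 2])).
        by apply: bigcup_finite => // i _; exact: contrapT (B_fin (v i)).
      have [x [Bx x_far]] := infinite_setN0 (infinite_setD B_inf fin).
      exists x; split=> // i i_n; rewrite leNgt; apply/negP => vx.
      by apply: x_far; exists i.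
    exists y; split=> // n m; rewrite neq_ltn => /orP[/y_sep//|/y_sep].
    by rewrite rhoC.
  exists (B `&` [set y | rho x y < e / 2]); split=> //.
  move=> y z [_ /= xy] [_ /= xz]; have := rho_triangle y z x.
  by rewrite [rho y x]rhoC; lra.
have /choice[f fP] (a : set M * nat) : exists B', infinite_set a.1 ->
    [/\ infinite_set B', B' `<=` a.1
      & forall x y, B' x -> B' y -> rho x y <= a.2.+1%:R^-1].
  have [a_inf|] := pselect (infinite_set a.1); last by exists set0.
  have [|B' B'P] := small_subset _ a.2.+1%:R^-1 a_inf; first by rewrite invr_gt0.
  by exists B' => _; exact: B'P.
pose B := fix B k := if k is j.+1 then f (B j, k) else f ([set: M], 0%N).
have B_inf k : infinite_set (B k).
  by elim: k => [|k IHk]; [case: (fP ([set: M], 0%N))|case: (fP (B k, k.+1))].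
have /choice[c Bc] k := infinite_setN0 (B_inf k).
apply: (bump_system_nested B_inf _ Bc) => k.
  by have [_ + _] := fP (B k, k.+1) (B_inf k).
by case: k => [|k]; [have [_ _] := fP ([set: M], 0%N) M_inf
                    |have [_ _] := fP (B k, k.+1) (B_inf k)].
Qed.

End bump_system.

(** * Reduced products of p-seminormed spaces *)

(** A sequence of p-th powers of p-seminorms on E.  The positivity of p is a
    field so that the structures built below depend on the gauges alone and can
    be inferred from them. *)
Record gauges (R : realType) (p : R) (E : lmodType R) := Gauges {
  gauge :> nat -> E -> R ;
  gauge_exponent_gt0 : 0 < p ;
  gauge_ge0 : forall k e, 0 <= gauge k e ;
  gaugeD : forall k e e', gauge k (e + e') <= gauge k e + gauge k e' ;
  gaugeZ : forall k c e, gauge k (c *: e) = `|c| `^ p * gauge k e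
}.

Section reduced_product.
Context (R : realType) (p : R) (E : lmodType R) (g : gauges p E).
Implicit Types (u v : nat -> E) (C : R).

Let p0 : 0 < p := gauge_exponent_gt0 g.

Definition gauge_bound v C := \forall k \near \oo, g k (v k) <= C.

(** The upper limit of g k (v k) when v is bounded, as the infimum of the
    eventual upper bounds. *)
Definition gauge_limsup v : R := inf [set C | gauge_bound v C].

Definition gauge_bounded : {pred nat -> E} :=
  [pred v | `[< exists C, gauge_bound v C >]].

Let gauge0 k : g k 0 = 0.
Proof. by rewrite -(scale0r 0) gaugeZ normr0 powR0 ?mul0r// gt_eqF. Qed.

Let gauge_bound_ge0 v C : gauge_bound v C -> 0 <= C.
Proof. by move=> /filter_ex[k]; exact/le_trans/gauge_ge0. Qed.

Let gauge_bound_le v C C' : C <= C' -> gauge_bound v C -> gauge_bound v C'.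
Proof. by move=> CC'; apply: filterS => k vC; exact: le_trans CC'. Qed.

Let gauge_boundD u v C C' : gauge_bound u C -> gauge_bound v C' ->
  gauge_bound (u + v) (C + C').
Proof.
move=> uC vC; near=> k; apply: le_trans (gaugeD _ _ _ _) _.
by apply: lerD; near: k.
Unshelve. all: by end_near. Qed.

Let gauge_boundZ c v C : gauge_bound v C -> gauge_bound (c *: v) (`|c| `^ p * C).
Proof.
by apply: filterS => k vC; rewrite [X in g k X]/= gaugeZ ler_wpM2l ?powR_ge0.
Qed.

Lemma gauge_limsup_le v C : gauge_bound v C -> gauge_limsup v <= C.
Proof. by move=> vC; apply: ge_inf => //; exists 0 => D /gauge_bound_ge0. Qed.

Lemma gauge_limsup_ge0 v : v \in gauge_bounded -> 0 <= gauge_limsup v.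
Proof.
by move=> /asboolP[C vC]; apply: lb_le_inf; [exists C|move=> D /gauge_bound_ge0].
Qed.

Lemma gauge_limsup_lt v C : v \in gauge_bounded -> gauge_limsup v < C ->
  gauge_bound v C.
Proof.
move=> /asboolP[D vD] vC; have [|C' vC' /ltW C'C] := inf_lt _ vC; first by exists D.
exact: gauge_bound_le vC'.
Qed.

Lemma gauge_limsup_ge v C : v \in gauge_bounded ->
  (\forall k \near \oo, C <= g k (v k)) -> C <= gauge_limsup v.
Proof.
move=> /asboolP[D vD] Cv; apply: lb_le_inf; first by exists D.
by move=> C' vC'; have [k [Ck kC']] := filter_ex (filterI Cv vC'); exact: le_trans kC'.
Qed.

Lemma gauge_limsupD u v : u \in gauge_bounded -> v \in gauge_bounded ->
  gauge_limsup (u + v) <= gauge_limsup u + gauge_limsup v.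
Proof.
move=> bu bv; apply/ler_addgt0Pr => e e0; rewrite [e]splitr addrACA.
by apply/gauge_limsup_le/gauge_boundD; apply: gauge_limsup_lt => //;
  rewrite ltrDl divr_gt0.
Qed.

Let gauge_bounded_submod : submod_closed gauge_bounded.
Proof.
split; first by apply/asboolP; exists 0; near=> k; rewrite gauge0.
move=> c u v /asboolP[C uC] /asboolP[D vD]; apply/asboolP.
by exists (`|c| `^ p * C + D); apply/gauge_boundD/vD/gauge_boundZ.
Unshelve. all: by end_near. Qed.

HB.instance Definition _ :=
  GRing.isSubmodClosed.Build R (nat -> E) gauge_bounded gauge_bounded_submod.

Lemma gauge_limsupZ c v : v \in gauge_bounded ->
  gauge_limsup (c *: v) = `|c| `^ p * gauge_limsup v.
Proof.
have le a w : w \in gauge_bounded -> gauge_limsup (a *: w) <= `|a| `^ p * gauge_limsup w.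
  move=> bw; apply/ler_addgt0Pr => e e0; set b := _ `^ p.
  have b1 : 0 < b + 1 by rewrite ltr_wpDl// powR_ge0.
  have : gauge_bound w (gauge_limsup w + e / (b + 1)).
    by apply: gauge_limsup_lt => //; rewrite ltrDl divr_gt0.
  move=> /(gauge_boundZ a)/gauge_limsup_le/le_trans; apply.
  rewrite -/b mulrDr lerD2l mulrCA -[leRHS]mulr1 ler_wpM2l ?ltW// ltr_pdivrMr//.
  by rewrite mul1r ltrDl.
(* The reverse inequality is the direct one for the scalar c^-1. *)
move=> bv; apply/eqP; rewrite eq_le le//=.
have [->|c0] := eqVneq c 0.
  by rewrite normr0 powR0 ?gt_eqF// mul0r scale0r gauge_limsup_ge0// rpred0.
rewrite -[v in leLHS](scalerK c0).
have := le c^-1 (c *: v) (rpredZ c bv).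
move=> /(ler_wpM2l (powR_ge0 `|c| p))/le_trans; apply.
by rewrite mulrA -powRM ?normr_ge0// -normrM mulfV// normr1 powR1 mul1r.
Qed.

Record bounded_seq := BoundedSeq {
  bounded_seq_val :> nat -> E ;
  bounded_seqP : bounded_seq_val \in gauge_bounded
}.

HB.instance Definition _ := [isSub for bounded_seq_val].
HB.instance Definition _ := [Choice of bounded_seq by <:].
HB.instance Definition _ := [SubChoice_isSubLmodule of bounded_seq by <:].

Definition limsup_mod (a : bounded_seq) : R := gauge_limsup a.

Lemma limsup_mod_ge0 a : 0 <= limsup_mod a.
Proof. exact/gauge_limsup_ge0/bounded_seqP. Qed.

Lemma limsup_modD a b : limsup_mod (a + b) <= limsup_mod a + limsup_mod b.
Proof. exact: gauge_limsupD (bounded_seqP a) (bounded_seqP b). Qed.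

Lemma limsup_modZ c a : limsup_mod (c *: a) = `|c| `^ p * limsup_mod a.
Proof. exact: gauge_limsupZ (bounded_seqP a). Qed.

Let limsup_modN a : limsup_mod (- a) = limsup_mod a.
Proof. by rewrite -scaleN1r limsup_modZ normrN1 powR1 mul1r. Qed.

Let limsup_mod0 : limsup_mod 0 = 0.
Proof. by rewrite -(scale0r 0) limsup_modZ normr0 powR0 ?mul0r// gt_eqF. Qed.

Definition limsup_equiv (a b : bounded_seq) : bool := limsup_mod (a - b) == 0.

Let limsup_equiv_refl : reflexive limsup_equiv.
Proof. by move=> a; rewrite /limsup_equiv subrr limsup_mod0. Qed.

Let limsup_equiv_sym : symmetric limsup_equiv.
Proof. by move=> a b; rewrite /limsup_equiv -opprB limsup_modN. Qed.

Let limsup_equiv_trans : transitive limsup_equiv.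
Proof.
move=> b a c /eqP ab /eqP bc; rewrite /limsup_equiv eq_le limsup_mod_ge0 andbT.
by rewrite -(subrK b a) -addrA (le_trans (limsup_modD _ _))// ab bc addr0.
Qed.

Canonical limsup_equiv_equiv :=
  EquivRel limsup_equiv limsup_equiv_refl limsup_equiv_sym limsup_equiv_trans.

Local Open Scope quotient_scope.

(** The analogue of l_oo(E_k) / c_0(E_k), where E_k is E with the k-th gauge. *)
Definition reduced : Type := {eq_quot limsup_equiv}.

HB.instance Definition _ := Choice.on reduced.
HB.instance Definition _ := EqQuotient.on reduced.

Let piP a b : reflect (\pi_reduced a = \pi_reduced b) (limsup_equiv a b).
Proof. by apply: (iffP idP) => [ab|/eqmodP//]; apply/eqmodP. Qed.

Let reduced0 : reduced := \pi_reduced 0.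
Let reducedN (x : reduced) : reduced := \pi_reduced (- repr x).
Let reducedD (x y : reduced) : reduced := \pi_reduced (repr x + repr y).
Let reducedZ (c : R) (x : reduced) : reduced := \pi_reduced (c *: repr x).

Let repr_equiv a : limsup_equiv (repr (\pi_reduced a)) a.
Proof. by apply/piP; rewrite reprK. Qed.

Let piN a : reducedN (\pi_reduced a) = \pi_reduced (- a).
Proof.
by apply/piP; rewrite /limsup_equiv -opprD limsup_modN; exact: repr_equiv.
Qed.

Let piD a b : reducedD (\pi_reduced a) (\pi_reduced b) = \pi_reduced (a + b).
Proof.
apply/piP; rewrite /limsup_equiv eq_le limsup_mod_ge0 andbT opprD addrACA.
rewrite (le_trans (limsup_modD _ _))//.
by rewrite (eqP (repr_equiv a)) (eqP (repr_equiv b)) addr0.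
Qed.

Let piZ c a : reducedZ c (\pi_reduced a) = \pi_reduced (c *: a).
Proof.
apply/piP; rewrite /limsup_equiv -scalerBr limsup_modZ.
by rewrite (eqP (repr_equiv a)) mulr0.
Qed.

Let reduced_addA : associative reducedD.
Proof.
elim/quotW=> a; elim/quotW=> b; elim/quotW=> c.
by rewrite (piD b c) (piD a b) (piD a (b + c)) (piD (a + b) c) addrA.
Qed.

Let reduced_addC : commutative reducedD.
Proof.
by elim/quotW=> a; elim/quotW=> b; rewrite (piD a b) (piD b a) addrC.
Qed.

Let reduced_add0 : left_id reduced0 reducedD.
Proof. by elim/quotW=> a; rewrite (piD 0 a) add0r. Qed.

Let reduced_addN : left_inverse reduced0 reducedN reducedD.
Proof. by elim/quotW=> a; rewrite (piN a) (piD (- a) a) addNr. Qed.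

HB.instance Definition _ := GRing.isZmodule.Build reduced
  reduced_addA reduced_addC reduced_add0 reduced_addN.

Let reduced_scaleA a b x : reducedZ a (reducedZ b x) = reducedZ (a * b) x.
Proof.
elim/quotW: x => x.
by rewrite (piZ b x) (piZ a (b *: x)) (piZ (a * b) x) scalerA.
Qed.

Let reduced_scale1 : left_id 1 reducedZ.
Proof. by elim/quotW=> a; rewrite (piZ 1 a) scale1r. Qed.

Let reduced_scaleDr : right_distributive reducedZ +%R.
Proof.
move=> c; elim/quotW=> a; elim/quotW=> b.
rewrite (piD a b : _ + _ = _) (piZ c a) (piZ c b) (piZ c (a + b)).
by rewrite (piD (c *: a) (c *: b) : _ + _ = _) scalerDr.
Qed.

Let reduced_scaleDl x : {morph reducedZ^~ x : a b / a + b}.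
Proof.
elim/quotW: x => x a b; rewrite (piZ (a + b) x) (piZ a x) (piZ b x).
by rewrite (piD (a *: x) (b *: x) : _ + _ = _) scalerDl.
Qed.

HB.instance Definition _ := GRing.Zmodule_isLmodule.Build R reduced
  reduced_scaleA reduced_scale1 reduced_scaleDr reduced_scaleDl.

Definition reduced_pi (a : bounded_seq) : reduced := \pi_reduced a.

Lemma reduced_pi_repr x : reduced_pi (repr x) = x.
Proof. exact: reprK. Qed.

Let reduced_pi_linear : linear reduced_pi.
Proof.
by move=> c a b; rewrite /reduced_pi -piD -piZ.
Qed.

HB.instance Definition _ :=
  GRing.isLinear.Build R bounded_seq reduced *:%R reduced_pi reduced_pi_linear.

Let limsup_mod_repr a : limsup_mod (repr (reduced_pi a)) = limsup_mod a.
Proof.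
have le b c : limsup_equiv b c -> limsup_mod b <= limsup_mod c.
  move=> /eqP bc; rewrite -(subrK c b) (le_trans (limsup_modD _ _))//.
  by rewrite bc add0r.
have ra : limsup_equiv (repr (reduced_pi a)) a by exact: repr_equiv.
by apply/eqP; rewrite eq_le le//= le// limsup_equiv_sym.
Qed.

Definition reduced_norm (x : reduced) : R := limsup_mod (repr x) `^ p^-1.

Let reduced_normE a : reduced_norm (reduced_pi a) = limsup_mod a `^ p^-1.
Proof. by rewrite /reduced_norm limsup_mod_repr. Qed.

Let reduced_norm_ge0 x : 0 <= reduced_norm x. Proof. exact: powR_ge0. Qed.

Let reduced_norm0_eq0 x : reduced_norm x = 0 -> x = 0.
Proof.
move=> /powR_eq0_eq0 x0; rewrite -[x]reprK; apply/piP.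
by rewrite /limsup_equiv subr0 x0.
Qed.

Let reduced_normZ c x : reduced_norm (c *: x) = `|c| * reduced_norm x.
Proof.
rewrite -[x]reprK -/(reduced_pi _) -linearZ !reduced_normE limsup_modZ.
by rewrite powRM ?powR_ge0 ?limsup_mod_ge0// powR_cancel.
Qed.

Let reduced_normD x y :
  reduced_norm (x + y) `^ p <= reduced_norm x `^ p + reduced_norm y `^ p.
Proof.
rewrite -[x]reprK -[y]reprK -/(reduced_pi _) -/(reduced_pi (repr y)) -linearD.
by rewrite !reduced_normE !powR_cancelV ?limsup_mod_ge0// limsup_modD.
Qed.

HB.instance Definition _ := @Lmodule_isPNormed.Build R p reduced
  p0 reduced_norm reduced_norm_ge0 reduced_norm0_eq0 reduced_normZ reduced_normD.

Lemma pmod_reduced_pi a : pmod (reduced_pi a) = limsup_mod a.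
Proof. by rewrite /pmod [pnorm _]reduced_normE powR_cancelV// limsup_mod_ge0. Qed.

End reduced_product.

Section reduced_complete.
Context (R : realType) (p : R) (E : lmodType R) (g : gauges p E).

Let p0 : 0 < p := gauge_exponent_gt0 g.

Let tol (n : nat) : R := n.+1%:R^-1.

Let tol_le m n : (m <= n)%N -> tol n <= tol m.
Proof. by move=> mn; rewrite /tol lef_pV2 ?posrE// ler_nat. Qed.

(** Completeness of the reduced product.  The representatives u n and u m are
    close at the index k once k is large in terms of n and m.  Let idx k be the
    largest m <= k such that u m is close at k to each of u 0, ..., u m; then idx
    tends to infinity and the diagonal sequence u (idx k) k is a limit. *)
Lemma reduced_diagonal (u : nat -> bounded_seq g) :
  (forall n m, pmod (reduced_pi (u n - u m)) < tol n + tol m) ->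
  exists v : bounded_seq g, forall n, pmod (reduced_pi (u n - v)) <= tol n *+ 2.
Proof.
move=> u_cauchy.
pose good k m := forall n, (n <= m)%N -> g k (u n k - u m k) <= tol n + tol m.
have good_near m : \forall k \near \oo, good k m.
  have : \forall k \near \oo, forall n : 'I_m.+1, g k (u n k - u m k) <= tol n + tol m.
    apply: filter_forall => n; apply: (@gauge_limsup_lt _ _ _ g (u n - u m)).
      exact: bounded_seqP.
    by have := u_cauchy n m; rewrite pmod_reduced_pi.
  by apply: filterS => k um n nm; exact: (um (Ordinal (nm : (n < m.+1)%N))).
have /choice[idx idxP] k : exists i,
    good k i /\ forall m, (m <= k)%N -> good k m -> (m <= i)%N.
  have good0 : exists m, (m <= k)%N && `[< good k m >].
    exists 0%N; apply/andP; split=> //; apply/asboolP => n; rewrite leqn0 => /eqP ->.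
    rewrite subrr -(scale0r 0) gaugeZ normr0 powR0 ?gt_eqF// mul0r.
    by rewrite addr_ge0// invr_ge0.
  have [m /andP[mk /asboolP gm] mmax] := ex_maxnP good0 (fun m => @proj1 _ _ \o elimT andP).
  by exists m; split=> // m' m'k gm'; apply: mmax; rewrite m'k; exact/asboolP.
pose v k := u (idx k) k.
have uv n : gauge_bound g ((u n : nat -> E) - v) (tol n *+ 2).
  near=> k; have [gk kmax] := idxP k.
  have nk : (n <= idx k)%N by apply: kmax; [near: k; exact: nbhs_infty_ge|near: k].
  by rewrite mulr2n (le_trans (gk n nk))// lerD2l tol_le.
have bv : v \in gauge_bounded g.
  rewrite -(subKr (u 0%N : nat -> E) v) rpredB ?bounded_seqP//.
  by apply/asboolP; exists (tol 0 *+ 2); exact: uv.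
exists (BoundedSeq bv) => n; rewrite pmod_reduced_pi.
exact/gauge_limsup_le/uv.
Unshelve. all: by end_near. Qed.

Let reduced_complete (G : set_system (reduced g)) :
  ProperFilter G -> cauchy G -> exists l : reduced g, G --> l.
Proof.
move=> PG cG.
have tol0 n : 0 < tol n by rewrite invr_gt0.
have [x xP] := choice (fun n => cauchy_pmod p0 PG cG (tol0 n)).
have reprE n m : reduced_pi (repr (x n) - repr (x m)) = x n - x m.
  by rewrite linearB/= !reduced_pi_repr.
have [|v vP] := @reduced_diagonal (fun n => repr (x n)).
  move=> n m; have [w [nw mw]] := filter_ex (filterI (xP n) (xP m)).
  rewrite (reprE n m); apply: le_lt_trans (pmod_dist_le (x n) (x m) w) _.
  by apply: ltrD; [exact: nw|rewrite pmodBC; exact: mw].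
exists (reduced_pi v); apply: (cvg_pmod p0) => e e0.
have [n] := ltr_add_invr (divr_gt0 e0 (ltr0Sn _ 2)); rewrite add0r -/(tol n) => ne.
apply: filterS (xP n) => w xw; apply: le_lt_trans (pmod_dist_le _ _ (x n)) _.
have vx : pmod (reduced_pi v - x n) <= tol n *+ 2.
  rewrite pmodBC; have := vP n.
  by rewrite linearB/= reduced_pi_repr.
have : 3 * tol n < e by rewrite mulrC -ltr_pdivlMr.
apply: le_lt_trans; rewrite mulr_natl mulrSr.
by apply: lerD; [exact: vx|exact/ltW/xw].
Qed.

HB.instance Definition _ := PNormed_isPBanach.Build R p (reduced g) reduced_complete.

End reduced_complete.

(** * A Lipschitz map with disjointly supported bumps *)

Lemma sum_ltn_min (a N : nat) : (\sum_(i < N) (i < a) = minn a N)%N.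
Proof.
elim: N => [|N IHN]; first by rewrite big_ord0 minn0.
by rewrite big_ord_recr/= IHN; case: (ltnP N a) => h; lia.
Qed.

Section step_sums.
Context (R : realType) (p : R) (p0 : 0 < p).

(** Indicators of initial segments differ on as many points as the difference
    of their lengths, and there the p-th power is 1 for every p. *)
Lemma sum_step_le (a b N : nat) :
  \sum_(i < N) `|(i < a)%:R - (i < b)%:R : R| `^ p <= `|a%:R - b%:R|.
Proof.
wlog ab : a b / (a <= b)%N => [le_ab|].
  have [/le_ab//|/ltnW/le_ab ba] := leqP a b.
  by rewrite distrC; under eq_bigr do rewrite distrC.
have stepE (i : 'I_N) :
    `|(i < a)%:R - (i < b)%:R : R| `^ p = ((i < b) - (i < a))%N%:R.
  have [ia|ai] := ltnP i a; first by rewrite (leq_trans ia ab) subrr normr0 powR0 ?gt_eqF.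
  by rewrite sub0r normrN subn0; case: ltnP => _; rewrite ?normr1 ?powR1// normr0 powR0 ?gt_eqF.
under eq_bigr do rewrite stepE.
rewrite -natr_sum distrC -natrB// normr_nat ler_nat.
rewrite sumnB => [|i _]; last by case: (ltnP i a) => // /leq_trans/(_ ab) ->.
by rewrite !sum_ltn_min; lia.
Qed.

Lemma sum_step_eq (a N : nat) : (a <= N)%N ->
  \sum_(i < N) `|(i < a)%:R : R| `^ p = a%:R.
Proof.
move=> aN; rewrite -[in RHS](minn_idPl aN) -sum_ltn_min natr_sum.
apply: eq_bigr => i _; case: ltnP => _; rewrite ?normr1 ?powR1//.
by rewrite normr0 powR0 ?gt_eqF.
Qed.

Lemma sum_single_le (k j : nat) (a : R) : 0 <= a ->
  \sum_(n < k) (if n == j :> nat then a else 0) <= a.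
Proof.
move=> a0; rewrite -big_mkcond/=; have [jk|kj] := ltnP j k.
  by rewrite (big_pred1 (Ordinal jk)).
by rewrite big1// => i /eqP ij; move: kj; rewrite -ij leqNgt ltn_ord.
Qed.

End step_sums.

Section grid_gauge.
Context (R : realType) (p : R) (hp : 0 < p <= 1).
Let p0 : 0 < p. Proof. by case/andP: hp. Qed.

(** A discrete L_p(N x [0, oo)): the k-th grid has the points (n, i / (k+1)) with
    n < k and i / (k+1) < k+1, each of mass 1 / (k+1), so it exhausts the product
    while its mesh tends to 0. *)
Definition grid_mean (k : nat) (e : nat -> nat -> R^o) : R :=
  k.+1%:R^-1 * \sum_(n < k) \sum_(i < k.+1 ^ 2) `|e n i| `^ p.

Let grid_mean_ge0 k e : 0 <= grid_mean k e.
Proof.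
by rewrite mulr_ge0 ?invr_ge0//; do 2?apply: sumr_ge0 => ? _; rewrite powR_ge0.
Qed.

Let grid_meanD k e e' : grid_mean k (e + e') <= grid_mean k e + grid_mean k e'.
Proof.
rewrite -mulrDr ler_wpM2l ?invr_ge0// -big_split/= ler_sum// => n _.
rewrite -big_split/= ler_sum// => i _.
apply: le_trans (powR_subadd hp (normr_ge0 _) (normr_ge0 _)).
by rewrite ler_powR_mono ?addr_ge0// ler_normD.
Qed.

Let grid_meanZ k c e : grid_mean k (c *: e) = `|c| `^ p * grid_mean k e.
Proof.
rewrite mulrCA; congr (_ * _); rewrite mulr_sumr; apply: eq_bigr => n _.
by rewrite mulr_sumr; apply: eq_bigr => i _; rewrite normrM powRM.
Qed.

Definition grid_gauge : gauges p (nat -> nat -> R^o) :=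
  Gauges p0 grid_mean_ge0 grid_meanD grid_meanZ.

Lemma grid_mean_step_le k (a b : nat -> nat) :
  grid_mean k (fun n i => (i < a n)%:R - (i < b n)%:R) <=
  k.+1%:R^-1 * \sum_(n < k) `|(a n)%:R - (b n)%:R|.
Proof.
by rewrite ler_wpM2l ?invr_ge0// ler_sum// => n _; exact: sum_step_le.
Qed.

End grid_gauge.

Section bump_map.
Context (R : realType) (p : R) (hp : 0 < p <= 1) (M : Type) (rho : M -> M -> R).
Hypothesis rho_ge0 : forall x y, 0 <= rho x y.
Hypothesis rhoC : forall x y, rho x y = rho y x.
Hypothesis rho_eq0 : forall x y, rho x y = 0 <-> x = y.
Hypothesis rho_triangle : forall x y z, rho x y <= rho x z + rho z y.
Context (x z : nat -> M) (r : nat -> R) (c : R).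
Hypothesis xzr : bump_system rho x z r c.

Let p0 : 0 < p. Proof. by case/andP: hp. Qed.

(* The index is 0 for points outside all the balls; the height is then 0, so
   that this default has no effect on the map. *)
Let ball_idx w : nat := xget 0%N [set n | rho w (x n) < r n].

Let height w : R := Num.max 0 (r (ball_idx w) - rho w (x (ball_idx w))).

Let r_gt0 n : 0 < r n. Proof. by case: xzr. Qed.

Let height_ge0 w : 0 <= height w. Proof. by rewrite le_max lexx. Qed.

Let ball_idxE w n : rho w (x n) < r n -> ball_idx w = n.
Proof.
move=> wn; rewrite /ball_idx; case: xgetP => [m _ /= wm|/(_ n)//].
apply/eqP; apply: contraTT isT => mn; have [_ _ _ sep _] := xzr.
have := sep _ _ mn; have := rho_triangle (x m) (x n) w.
by rewrite [rho (x m) w]rhoC; lra.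
Qed.

Let height_gt0 w : 0 < height w ->
  rho w (x (ball_idx w)) < r (ball_idx w) /\
  height w = r (ball_idx w) - rho w (x (ball_idx w)).
Proof.
rewrite /height lt_max ltxx/= => w0; split; first by rewrite -subr_gt0.
exact/max_idPr/ltW.
Qed.

(* The next two facts say that the sets {ball_idx v} x [0, height v] and
   {ball_idx w} x [0, height w] have a symmetric difference of measure at most
   rho v w. *)
Let height_lip v w : ball_idx v = ball_idx w -> `|height v - height w| <= rho v w.
Proof.
move=> vw; rewrite /height vw; set n := ball_idx w.
have := rho_triangle v (x n) w; have := rho_triangle w (x n) v.
rewrite [rho w v]rhoC ler_norml; have := rho_ge0 v w.
by case: (leP 0 (r n - rho v (x n))); case: (leP 0 (r n - rho w (x n))); lra.
Qed.

Let height_sum v w : ball_idx v <> ball_idx w -> height v + height w <= rho v w.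
Proof.
have single a b : ball_idx a <> ball_idx b -> 0 < height a -> height a <= rho a b.
  move=> ab /height_gt0[ar ->].
  have : r (ball_idx a) <= rho b (x (ball_idx a)).
    by rewrite leNgt; apply/negP => /ball_idxE/esym.
  by have := rho_triangle b (x (ball_idx a)) a; rewrite [rho b a]rhoC; lra.
move=> vw; have := rho_ge0 v w; have := height_ge0 v; have := height_ge0 w.
have [v0|v0] := ltP 0 (height v); have [w0|w0] := ltP 0 (height w).
- have [_ _ _ sep _] := xzr; have /eqP vw' := vw; have := sep _ _ vw'.
  have [_ ->] := height_gt0 v0; have [_ ->] := height_gt0 w0.
  have := rho_triangle (x (ball_idx v)) (x (ball_idx w)) v.
  have := rho_triangle v (x (ball_idx w)) w.
  by rewrite [rho (x _) v]rhoC; lra.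
- by have := single v w vw v0; lra.
- by have := single w v (fun e => vw (esym e)) w0; rewrite rhoC; lra.
- by lra.
Qed.

Let height_center n : ball_idx (x n) = n /\ height (x n) = r n.
Proof.
have xx : rho (x n) (x n) = 0 by apply/rho_eq0.
have idx : ball_idx (x n) = n by apply: ball_idxE; rewrite xx.
by split=> //; rewrite /height idx xx subr0; exact/max_idPr/ltW.
Qed.

Let height_foot n : height (z n) = 0.
Proof.
apply/max_idPl; rewrite subr_le0 rhoC.
by have [_ _ _ _ ->] := xzr.
Qed.

(* Height of w over n, in steps of the k-th grid. *)
Let level w k n : nat :=
  if n == ball_idx w then Num.truncn (height w * k.+1%:R) else 0%N.

Let bump w k n i : R^o := (i < level w k n)%:R.

Let level_le w k n :
  (level w k n)%:R <= (if n == ball_idx w then height w * k.+1%:R else 0) :> R.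
Proof.
by rewrite /level; case: ifP => // _; rewrite truncn_le mulr_ge0.
Qed.

Let level_sum w k : \sum_(n < k) (level w k n)%:R <= height w * k.+1%:R :> R.
Proof.
apply: le_trans (sum_single_le k (ball_idx w) (mulr_ge0 (height_ge0 w) (ler0n R _))).
by apply: ler_sum => n _; exact: level_le.
Qed.

(* Rounding heights to the grid costs at most one point, and only in the case
   of equal indices; divided by k+1 this is negligible. *)
Let level_dist v w k :
  \sum_(n < k) `|(level v k n)%:R - (level w k n)%:R| <= rho v w * k.+1%:R + 1 :> R.
Proof.
have k0 : 0 < k.+1%:R :> R by rewrite ltr0n.
have [vw|vw] := eqVneq (ball_idx v) (ball_idx w).
  set D := leRHS; have D0 : 0 <= D by rewrite addr_ge0// mulr_ge0.
  apply: le_trans (sum_single_le k (ball_idx w) D0); apply: ler_sum => n _.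
  rewrite /level vw; case: ifP => _; last by rewrite subrr normr0.
  set a := height v * _; set b := height w * _.
  have lip : `|a - b| <= rho v w * k.+1%:R.
    by rewrite /a /b -mulrBl normrM (gtr0_norm k0) ler_pM2r// height_lip.
  have a0 : 0 <= a by rewrite mulr_ge0// ltW.
  have b0 : 0 <= b by rewrite mulr_ge0// ltW.
  have := truncn_itv a0; have := truncn_itv b0; move: lip; rewrite /D.
  move: (rho v w * _) => d; rewrite !ler_norml -2!natr1 => /andP[? ?] /andP[? ?] /andP[? ?].
  by apply/andP; split; lra.
apply: (@le_trans _ _ (\sum_(n < k) (level v k n)%:R + \sum_(n < k) (level w k n)%:R)).
  rewrite -big_split/=; apply: ler_sum => n _.
  by apply: le_trans (ler_normB _ _) _; rewrite !normr_nat.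
apply: le_trans (lerD (level_sum v k) (level_sum w k)) _.
rewrite -mulrDl ler_wpDr//; apply: ler_wpM2r; first exact: ltW.
by apply: height_sum; exact/eqP.
Qed.

Let bump_bounded w : bump w \in gauge_bounded (grid_gauge hp).
Proof.
apply/asboolP; exists (height w); apply: nearW => k.
have -> : bump w k = fun n i => (i < level w k n)%:R - (i < 0)%:R.
  by apply/funext => n; apply/funext => i; rewrite subr0.
apply: le_trans (grid_mean_step_le hp _ _ _) _.
rewrite mulrC ler_pdivrMr//.
by under eq_bigr do rewrite subr0 normr_nat.
Qed.

Let bump_seq w : bounded_seq (grid_gauge hp) := BoundedSeq (bump_bounded w).

Let bump_map w : reduced (grid_gauge hp) := reduced_pi (bump_seq w).

Let bump_map_lip v w : pmod (bump_map v - bump_map w) <= rho v w.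
Proof.
rewrite /bump_map -linearB/= pmod_reduced_pi.
apply/ler_addgt0Pr => e e0; apply: gauge_limsup_le.
near=> k; apply: (@le_trans _ _ (k.+1%:R^-1 * (rho v w * k.+1%:R + 1))).
  apply: le_trans (grid_mean_step_le hp _ _ _) _.
  by rewrite ler_wpM2l ?invr_ge0//; exact: level_dist.
rewrite mulrDr mulr1 mulrCA mulVf ?mulr1 ?pnatr_eq0// lerD2l ltW//.
by near: k; exact: (near_infty_natSinv_lt (PosNum e0)).
Unshelve. all: by end_near. Qed.

Let bump_combination K (b : nat -> R) (k n i : nat) : (n < K)%N ->
  (\sum_(m < K) b m *: (bump_seq (x m) - bump_seq (z m)) : bounded_seq _) k n i =
  b n * (i < Num.truncn (r n * k.+1%:R))%:R.
Proof.
move=> nK.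
rewrite (big_morph (fun a : bounded_seq (grid_gauge hp) => a k n i) (id1 := 0) (op1 := +%R))//.
have bumpE m : bump (x m) k n i - bump (z m) k n i =
    if n == m then (i < Num.truncn (r m * k.+1%:R))%:R else 0.
  rewrite /bump /level height_foot mul0r truncn0 if_same subr0.
  by have [-> ->] := height_center m; case: ifP.
rewrite (bigD1 (Ordinal nK))//= [X in _ + X]big1 => [|m nm].
  by rewrite addr0 [LHS]/(b n * (bump (x n) k n i - bump (z n) k n i)) bumpE eqxx.
rewrite [LHS]/(b m * (bump (x m) k n i - bump (z m) k n i)) bumpE.
move: nm; rewrite -val_eqE/= eq_sym => /negPf ->.
exact: mulr0.
Qed.

Let bump_map_lower K (b : nat -> R) :
  \sum_(n < K) `|b n| `^ p * (r n / 2) <=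
  pmod (\sum_(n < K) b n *: (bump_map (x n) - bump_map (z n))).
Proof.
have -> : \sum_(n < K) b n *: (bump_map (x n) - bump_map (z n)) =
    reduced_pi (\sum_(n < K) b n *: (bump_seq (x n) - bump_seq (z n))).
  by rewrite linear_sum; apply: eq_bigr => n _; rewrite linearZ [in RHS]linearB.
rewrite pmod_reduced_pi; apply: gauge_limsup_ge; first exact: bounded_seqP.
near=> k.
have kK : (K <= k)%N by near: k; exact: nbhs_infty_ge.
have r_fine : forall n : 'I_K, k.+1%:R^-1 < r n / 2.
  near: k; apply: filter_forall => n.
  by exact: (near_infty_natSinv_lt (PosNum (divr_gt0 (r_gt0 n) (ltr0Sn _ 1)))).
have r_le : forall n : 'I_K, r n <= k.+1%:R.
  near: k; apply: filter_forall => n; near=> k.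
  by rewrite (le_trans (ltW (truncnS_gt (r n))))// ler_nat ltnS; near: k; exact: nbhs_infty_ge.
have k0 : 0 < k.+1%:R :> R by rewrite ltr0n.
rewrite [leRHS]mulrC ler_pdivlMr// mulr_suml.
apply: (@le_trans _ _ (\sum_(n < K) \sum_(i < k.+1 ^ 2)
    `|b n * (i < Num.truncn (r n * k.+1%:R))%:R| `^ p)).
  apply: ler_sum => n _; under eq_bigr do rewrite normrM powRM//.
  have r0 : 0 <= r n * k.+1%:R by rewrite mulr_ge0 ?ltW.
  rewrite -mulr_sumr sum_step_eq//; last first.
    rewrite -(ler_nat R) (le_trans (_ : _ <= r n * k.+1%:R))// ?truncn_le//.
    by rewrite natrX expr2 ler_pM2r.
  rewrite -mulrA ler_wpM2l ?powR_ge0//.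
  have /andP[_] := truncn_itv r0; rewrite -[_.+1%:R]natr1; have := r_fine n.
  rewrite -(ltr_pM2r k0) mulVf ?pnatr_eq0//; lra.
rewrite (big_ord_widen k (fun n => \sum_(i < k.+1 ^ 2)
    `|b n * (i < Num.truncn (r n * k.+1%:R))%:R| `^ p) kK) big_mkcond/=.
apply: ler_sum => n _; case: ifP => nK.
  by apply: ler_sum => i _; rewrite (bump_combination b k i nK).
by apply: sumr_ge0 => i _; rewrite powR_ge0.
Unshelve. all: by end_near. Qed.

(** Half of r n is a crude lower bound for the total mass of the grid points
    below the height r n, valid on all sufficiently fine grids. *)
Theorem exists_bump_map : exists (X : pBanachType p) (f : M -> X),
  (forall v w, pmod (f v - f w) <= rho v w) /\
  forall K (b : nat -> R), \sum_(n < K) `|b n| `^ p * (r n / 2) <=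
    pmod (\sum_(n < K) b n *: (f (x n) - f (z n))).
Proof. by exists (reduced (grid_gauge hp)), bump_map. Qed.

End bump_map.

(** * Limits in p-normed spaces and operators bounded from below *)

Section sequences.
Context (R : realType) (p : R) (p0 : 0 < p).

Definition pmod_cauchy (V : pNormedType p) (v : nat -> V) :=
  forall e, 0 < e -> exists N, forall j, (N <= j)%N -> pmod (v N - v j) < e.

Definition pmod_cvg (V : pNormedType p) (v : nat -> V) (l : V) :=
  forall e, 0 < e -> \forall n \near \oo, pmod (l - v n) < e.

Lemma pmod_le0 (V : pNormedType p) (v : V) :
  (forall e, 0 < e -> pmod v <= e) -> v = 0.
Proof.
move=> ve; apply: pmod_eq0; apply/eqP; rewrite eq_le pmod_ge0 andbT.
by apply/ler_addgt0Pr => e /ve; rewrite add0r.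
Qed.

Lemma pmod_cvg_unique (V : pNormedType p) (v : nat -> V) l l' :
  pmod_cvg v l -> pmod_cvg v l' -> l = l'.
Proof.
move=> vl vl'; apply/eqP; rewrite -subr_eq0; apply/eqP/pmod_le0 => e e0.
have e20 : 0 < e / 2 by rewrite divr_gt0.
have [n [nl nl']] := filter_ex (filterI (vl _ e20) (vl' _ e20)).
apply: le_trans (pmod_dist_le _ _ (v n)) _; rewrite [e]splitr.
by apply: lerD; [exact/ltW/nl|rewrite pmodBC; exact/ltW/nl'].
Qed.

Lemma pmod_cvgZD (V : pNormedType p) (v w : nat -> V) c l l' :
  pmod_cvg v l -> pmod_cvg w l' ->
  pmod_cvg (fun n => c *: v n + w n) (c *: l + l').
Proof.
move=> vl wl' e e0; have e20 : 0 < e / 2 by rewrite divr_gt0.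
have c0 : 0 < `|c| `^ p + 1 by rewrite ltr_wpDl ?powR_ge0.
near=> n; rewrite opprD addrACA -scalerBr; apply: le_lt_trans (pmodD _ _) _.
rewrite [e]splitr; apply: ltr_leD; last first.
  by apply/ltW; near: n; exact: wl'.
have vn : pmod (l - v n) < e / 2 / (`|c| `^ p + 1).
  by near: n; apply: vl; rewrite divr_gt0.
rewrite pmodZ; apply: le_lt_trans (_ : _ <= (`|c| `^ p + 1) * pmod (l - v n)) _.
  by rewrite ler_wpM2r ?pmod_ge0// lerDl.
by rewrite mulrC -ltr_pdivlMr.
Unshelve. all: by end_near. Qed.

Lemma pbanach_pmod_cvg (V : pBanachType p) (v : nat -> V) :
  pmod_cauchy v -> exists l, pmod_cvg v l.
Proof.
move=> vc; have [|l vl] := @pcauchy_cvg R p V (v n @[n --> \oo]) _.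
  move=> A /(entourage_pmod p0)[e e0 eA].
  have [N vN] := vc _ (divr_gt0 e0 (ltr0Sn _ 1)).
  exists ([set w | pmod (v N - w) < e / 2], [set w | pmod (v N - w) < e / 2]).
    by split; exists N => // j /= /vN.
  move=> [w w'] [/= wN wN']; apply: eA; apply: le_lt_trans (pmod_dist_le _ _ (v N)) _.
  by rewrite [e]splitr; apply: ltrD => //; rewrite pmodBC.
exists l => e e0; apply: (vl [set w | pmod (l - w) < e]).
by apply/nbhs_pmod => //; exists e.
Qed.

(** If T (a n) tends to y, the lower bound makes a n a Cauchy sequence, and T maps
    its limit to y: the range is closed.  The inverse is continuous on the range,
    by the same lower bound. *)
Lemma isomorphic_copy_of_bounds (E F : pNormedType p) (T : {linear E -> F}) (c : R) :
  0 < c -> (forall v : nat -> E, pmod_cauchy v -> exists l, pmod_cvg v l) ->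
  (forall a, pmod (T a) <= pmod a) -> (forall a, c * pmod a <= pmod (T a)) ->
  contains_isomorphic_copy E F.
Proof.
move=> c0 E_complete T_le T_ge.
have T_inj : injective T.
  move=> a b Tab; apply/eqP; rewrite -subr_eq0; apply/eqP/pmod_le0 => e /ltW e0.
  apply: le_trans e0; rewrite -(pmulr_rle0 _ c0); apply: le_trans (T_ge _) _.
  by rewrite linearB Tab subrr pmod0.
have /choice[S SP] (y : F) : exists a, range T y -> T a = y.
  by have [[a _ <-]|yT] := pselect (range T y); [exists a|exists 0].
have TK : cancel T S by move=> a; apply/T_inj/SP; exists a.
exists (range T); split.
- split; first by apply/mem_set; exists 0; rewrite ?linear0.
  by move=> k x y /set_mem[a _ <-] /set_mem[b _ <-]; apply/mem_set;
    exists (k *: a + b); rewrite ?linearP.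
- move=> y Ty.
  have tol0 n : 0 < n.+1%:R^-1 :> R by rewrite invr_gt0.
  have /choice[a aP] n : exists a, pmod (y - T a) < n.+1%:R^-1.
    have [|w [[a _ <-] yw]] := Ty [set w | pmod (y - w) < n.+1%:R^-1].
      by apply/nbhs_pmod => //; exists n.+1%:R^-1.
    by exists a.
  have a_cauchy : pmod_cauchy a.
    move=> e e0; have [n] := ltr_add_invr (divr_gt0 (mulr_gt0 c0 e0) (ltr0Sn _ 1)).
    rewrite add0r => ne; exists n => j nj; rewrite -(ltr_pM2l c0).
    apply: le_lt_trans (T_ge _) _; rewrite linearB.
    apply: le_lt_trans (pmod_dist_le _ _ y) _; rewrite [c * e]splitr.
    apply: ltrD; first by rewrite pmodBC; exact: lt_trans ne.
    by apply: lt_trans (aP j) _; apply: le_lt_trans ne; rewrite lef_pV2 ?posrE// ler_nat ltnS.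
  have [l al] := E_complete a a_cauchy; exists l => //; apply/eqP.
  rewrite -subr_eq0; apply/eqP/pmod_le0 => e e0; rewrite [e]splitr.
  have e20 : 0 < e / 2 by rewrite divr_gt0.
  have [n [nl ne]] := filter_ex (filterI (al _ e20) (near_infty_natSinv_lt (PosNum e20))).
  apply: le_trans (pmod_dist_le _ _ (T (a n))) _; rewrite -linearB; apply: lerD.
    exact: le_trans (T_le _) (ltW nl).
  by rewrite pmodBC; exact/ltW/(lt_trans (aP n)).
exists T, S; split=> //.
- move=> a; apply: (cvg_pmod p0) => e e0.
  apply/nbhs_pmod => //; exists e => // b ab /=.
  by rewrite -linearB; exact: le_lt_trans (T_le _) ab.
- apply/subspace_continuousP => _ [a _ <-]; rewrite /from_subspace TK.
  apply: (cvg_pmod p0) => e e0; apply/nbhs_pmod => //.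
  exists (c * e); first exact: mulr_gt0.
  move=> _ /[swap] -[b _ <-] /=; rewrite TK -linearB => ab.
  by rewrite -(ltr_pM2l c0); exact: le_lt_trans (T_ge _) ab.
Qed.

End sequences.

(** * The space ell_p and basic sequences equivalent to its unit vectors *)

Section ellp_theory.
Context (R : realType) (p : R) (hp : 0 < p <= 1).
Implicit Types (a b : ellp hp).

Let p0 : 0 < p. Proof. by case/andP: hp. Qed.

Let ellp_terms_nd (s : nat -> R^o) : nondecreasing_seq (series (ellp_terms p s)).
Proof. by apply: nondecreasing_series => i _ _; exact: powR_ge0. Qed.

Let seriesE (s : nat -> R^o) K :
  series (ellp_terms p s) K = \sum_(n < K) `|s n| `^ p.
Proof. by rewrite /series/= big_mkord. Qed.

Let ellp_cvgn a : cvgn (series (ellp_terms p a)).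
Proof. exact/asboolP/(ellp_seqP a). Qed.

Let ellp_le_lim a K : \sum_(n < K) `|a n| `^ p <= limn (series (ellp_terms p a)).
Proof.
by rewrite -seriesE; exact: nondecreasing_cvgn_le (ellp_terms_nd a) (@ellp_cvgn a) K.
Qed.

Lemma ellp_modE a : pmod a = limn (series (ellp_terms p a)).
Proof.
rewrite /pmod [pnorm a]/(ellp_norm a) powR_cancelV//.
by have := ellp_le_lim a 0; rewrite big_ord0.
Qed.

Lemma ellp_sum_le a K : \sum_(n < K) `|a n| `^ p <= pmod a.
Proof. by rewrite ellp_modE ellp_le_lim. Qed.

Lemma ellp_sum_cvg a e : 0 < e ->
  \forall K \near \oo, pmod a - e < \sum_(n < K) `|a n| `^ p.
Proof.
move=> e0; have /cvgrPdist_lt/(_ _ e0) := @ellp_cvgn a.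
apply: filterS => K; rewrite seriesE ltr_norml -[limn _]ellp_modE => /andP[_].
by rewrite ltrBlDr ltrBlDl.
Qed.

Lemma ellp_mod_le a C : (forall K, \sum_(n < K) `|a n| `^ p <= C) -> pmod a <= C.
Proof.
move=> aC; apply/ler_addgt0Pr => e e0.
have [K] := filter_ex (ellp_sum_cvg a e0); rewrite ltrBlDr => /ltW/le_trans; apply.
by rewrite lerD2r.
Qed.

Lemma ellp_of_sums (s : nat -> R^o) C :
  (forall K, \sum_(n < K) `|s n| `^ p <= C) -> exists a, ellp_seq a = s.
Proof.
move=> sC; suff sP : s \in ellp_pred hp by exists (EllP sP).
apply/asboolP; apply: nondecreasing_is_cvgn; first exact: ellp_terms_nd.
by exists C => _ [K _ <-]; rewrite seriesE.
Qed.

(** The limit is taken coordinatewise.  Bounds on finite partial sums pass to the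
    limit, and a uniform bound on them is a bound on the modulus. *)
Lemma ellp_complete (v : nat -> ellp hp) : pmod_cauchy v ->
  exists l, pmod_cvg v l.
Proof.
move=> v_cauchy.
have coord_le a n : `|a n| `^ p <= pmod a.
  apply: le_trans (ellp_sum_le a n.+1); rewrite big_ord_recr/= lerDr.
  by apply: sumr_ge0 => i _; rewrite powR_ge0.
have coord_cvg n : cvgn (fun j => v j n : R).
  apply: real_cauchy_cvg => e e0; have [N vN] := v_cauchy _ (powR_gt0 p e0).
  exists N => j /vN vNj; rewrite -(ltr_powR_mono p0) ?normr_ge0 ?(ltW e0)//.
  exact: le_lt_trans (coord_le (v N - v j) n) vNj.
pose s n : R^o := limn (fun j => v j n : R).
have dist_le m e : 0 < e -> (forall j, (m <= j)%N -> pmod (v m - v j) < e) ->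
    forall K, \sum_(n < K) `|v m n - s n| `^ p <= e.
  move=> e0 vm K; apply/ler_addgt0Pr => t t0.
  have K0 : 0 < K.+1%:R :> R by rewrite ltr0n.
  near \oo => j.
  have mj : (m <= j)%N by near: j; exact: nbhs_infty_ge.
  have vjs : forall n : 'I_K, `|v j n - s n| < (t / K.+1%:R) `^ p^-1.
    near: j; apply: filter_forall => n; have /cvgrPdist_lt := coord_cvg n.
    move=> /(_ _ (powR_gt0 p^-1 (divr_gt0 t0 K0))).
    by apply: filterS => j; rewrite distrC.
  apply: (@le_trans _ _ (\sum_(n < K) (`|(v m - v j) n| `^ p + t / K.+1%:R))).
    apply: ler_sum => n _; rewrite -(subrK (v j n) (v m n)) -addrA.
    apply: le_trans (_ : _ <= `|(v m - v j) n| `^ p + `|v j n - s n| `^ p) _.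
      apply: le_trans (powR_subadd hp (normr_ge0 _) (normr_ge0 _)).
      by rewrite ler_powR_mono ?addr_ge0//; exact: ler_normD.
    rewrite lerD2l -[leRHS](powR_cancelV p0) ?divr_ge0// ?ltW//.
    by rewrite ltr_powR_mono ?powR_ge0.
  rewrite big_split/=; apply: lerD.
    exact: le_trans (ellp_sum_le _ _) (ltW (vm j mj)).
  rewrite sumr_const card_ord -[leLHS]mulr_natr -mulrA ler_piMr ?ltW//.
  by rewrite mulrC ltr_pdivrMr// mul1r ltr_nat.
have [N0 vN0] := v_cauchy 1 ltr01.
have [b bE] := @ellp_of_sums (fun n => v N0 n - s n) 1 (dist_le _ _ ltr01 vN0).
have lE : ellp_seq (v N0 - b) = s.
  by apply/funext => n; rewrite [LHS]/(v N0 n - b n) bE; exact: subKr.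
exists (v N0 - b) => e e0; have e20 : 0 < e / 2 by rewrite divr_gt0.
have [N vN] := v_cauchy _ e20; exists N => // j /= Nj.
apply: le_lt_trans (pmod_dist_le _ _ (v N)) _; rewrite [e]splitr.
apply: ler_ltD; last exact: vN.
rewrite pmodBC; apply: ellp_mod_le => K.
have := dist_le _ _ e20 vN K; congr (_ <= _); apply: eq_bigr => n _.
by rewrite -lE.
Unshelve. all: by end_near. Qed.

(** The upper estimate makes the series sum_n a n *: u n converge for every a in
    ell_p, and both estimates pass from its partial sums to its sum. *)
Lemma ellp_copy_of_basic_sequence (F : pBanachType p) (u : nat -> F) (c : R) :
  0 < c -> (forall n, pmod (u n) <= 1) ->
  (forall K (b : nat -> R),
    c * \sum_(n < K) `|b n| `^ p <= pmod (\sum_(n < K) b n *: u n)) ->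
  contains_isomorphic_copy (ellp hp) F.
Proof.
move=> c0 u_le u_ge.
pose S (a : ellp hp) K : F := \sum_(n < K) a n *: u n.
have S_le (a : ellp hp) K : pmod (S a K) <= pmod a.
  apply: le_trans (ellp_sum_le a K); apply: le_trans (pmod_sum p0 _ _ _) _.
  by apply: ler_sum => n _; rewrite pmodZ ler_piMr ?powR_ge0.
have S_cauchy (a : ellp hp) : pmod_cauchy (S a).
  move=> e e0; have [N _ aN] := ellp_sum_cvg a e0; exists N => j Nj.
  have := ellp_sum_le a j; have := aN N (leqnn N); rewrite /S /=.
  rewrite -!(big_mkord xpredT (fun n => `|a n| `^ p)).
  rewrite -!(big_mkord xpredT (fun n => a n *: u n)).
  rewrite !(big_cat_nat (leq0n N) Nj)/= pmodBC => aN' aj.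
  rewrite addrAC subrr add0r; apply: le_lt_trans (_ : _ <= \sum_(N <= n < j) `|a n| `^ p) _.
    apply: le_trans (pmod_sum p0 _ _ _) _.
    by apply: ler_sum => n _; rewrite pmodZ ler_piMr ?powR_ge0.
  by move: aN' aj; lra.
have /choice[T TP] a := pbanach_pmod_cvg p0 (S_cauchy a).
have T_linear : linear T.
  move=> k a b; apply: (pmod_cvg_unique (TP _)).
  move=> e e0; have := pmod_cvgZD k (TP a) (TP b) e0.
  apply: filterS => K; congr (pmod (_ - _) < _).
  rewrite /S scaler_sumr -big_split/=; apply: eq_bigr => n _.
  by rewrite scalerA -scalerDl.
pose TL : {linear ellp hp -> F} :=
  HB.pack T (GRing.isLinear.Build R (ellp hp) F *:%R T T_linear).
apply: (@isomorphic_copy_of_bounds R p p0 (ellp hp) F TL c c0 ellp_complete) => a /=.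
  apply/ler_addgt0Pr => e e0; have [K /ltW aK] := filter_ex (TP a e e0).
  rewrite -(subrK (S a K) (T a)); apply: le_trans (pmodD _ _) _.
  by rewrite addrC lerD.
apply/ler_addgt0Pr => e e0.
have d0 : 0 < e / (c + 1) by rewrite divr_gt0// addr_gt0.
have [K [/ltW TK /ltW aK]] := filter_ex (filterI (TP a _ d0) (ellp_sum_cvg a d0)).
have := u_ge K a; have := pmod_dist_le (S a K) 0 (T a).
rewrite !subr0 pmodBC -/(S a K) => S_T S_ge.
have cd : (c + 1) * (e / (c + 1)) = e by rewrite mulrC divfK// gt_eqF// addr_gt0.
have := ler_wpM2l (ltW c0) aK; move: (e / _) cd TK => d.
by rewrite mulrDl mul1r mulrBr; lra.
Qed.

End ellp_theory.

(** * Embedding ell_p into the free space *)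

Lemma opnormP (R : realType) (p : R) (p0 : 0 < p) (E X : pNormedType p)
  (T : {linear E -> X}) : bounded_pmap T ->
  forall v, pnorm (T v) <= opnorm T * pnorm v.
Proof.
move=> [C TC] v.
have T_ub : has_ubound [set pnorm (T w) | w in [set w : E | pnorm w <= 1]].
  exists `|C| => _ [w /= w1 <-]; apply: le_trans (TC w) _.
  apply: le_trans (ler_wpM2r (pnorm_ge0 w) (ler_norm C)) _.
  by rewrite ler_piMr.
have [/pnorm0_eq0 ->|v0] := eqVneq (pnorm v) 0.
  by rewrite linear0 !pnorm0 mulr0.
have {}v0 : 0 < pnorm v by rewrite lt0r v0 pnorm_ge0.
rewrite -ler_pdivrMr//; apply: ub_le_sup => //.
exists ((pnorm v)^-1 *: v) => /=.
  by rewrite pnormZ gtr0_norm ?invr_gt0// mulVf// gt_eqF.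
by rewrite linearZ pnormZ gtr0_norm ?invr_gt0// mulrC.
Qed.

Theorem theorem3p1 (R : realType) (p : R) (hp : 0 < p <= 1)
    (M : Type) (d : M -> M -> R) (hd : is_pmetric p d)
    (hM : infinite_set [set: M]) (x0 : M)
    (F : pBanachType p) (delta : M -> F)
    (hF : is_free_pspace d x0 delta) :
  contains_isomorphic_copy (ellp hp) F.
Proof.
have /andP[p0 _] := hp.
have [d_ge0 dC d_eq0 d_triangle] := hd; have [delta_iso _ delta_univ] := hF.
pose rho v w := d v w `^ p.
have rho_ge0 v w : 0 <= rho v w by exact: powR_ge0.
have rhoC v w : rho v w = rho w v by rewrite /rho dC.
have rho_eq0 v w : rho v w = 0 <-> v = w.
  rewrite -d_eq0; split=> [/powR_eq0_eq0//|vw].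
  by rewrite /rho vw powR0// gt_eqF.
have [x [z [r [c xzr]]]] := exists_bump_system rho_ge0 rhoC rho_eq0 d_triangle hM.
have [c0 r0 cr _ r_xz] := xzr.
have d_xz n : 0 < d (x n) (z n).
  rewrite lt0r d_ge0 andbT; apply/eqP => /d_eq0 xz.
  have := lt_le_trans (r0 n) (r_xz n n).
  by rewrite xz (rho_eq0 _ _).2 ?ltxx.
have [X [f [f_lip f_lower]]] :=
  exists_bump_map hp rho_ge0 rhoC rho_eq0 d_triangle xzr.
have f_lip_d v w : pnorm (f v - f w) <= d v w.
  by rewrite -(ler_powR_mono p0) ?pnorm_ge0//; exact: f_lip.
(* The universal property concerns maps that vanish at the base point. *)
pose f0 v := f v - f x0.
have f0B v w : f0 v - f0 w = f v - f w by rewrite /f0 opprB addrA subrK.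
have [||T [T_bounded Tf T_norm _]] := delta_univ X f0.
- exact: subrr.
- by exists 1 => v w; rewrite f0B mul1r.
have T_le v : pmod (T v) <= pmod v.
  rewrite ler_powR_mono ?pnorm_ge0//; apply: le_trans (opnormP p0 T_bounded v) _.
  rewrite ler_piMl ?pnorm_ge0// T_norm; apply: sup_le_ub.
    exists (pnorm (f0 (x 0%N) - f0 (z 0%N)) / d (x 0%N) (z 0%N)).
    exists (x 0%N, z 0%N) => //= xz; have := d_xz 0%N.
    by rewrite (d_eq0 _ _).2 ?ltxx.
  move=> _ [[v' w'] /= vw <-]; rewrite f0B ler_pdivrMr ?mul1r//.
  by rewrite lt0r d_ge0 andbT; apply/eqP => /d_eq0.
pose u n := (d (x n) (z n))^-1 *: (delta (x n) - delta (z n)).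
apply: (@ellp_copy_of_basic_sequence R p hp F u (c / 2)) => [|n|K b].
- by rewrite divr_gt0.
- rewrite /pmod pnormZ delta_iso gtr0_norm ?invr_gt0// mulVf ?powR1//.
  by rewrite gt_eqF.
apply: le_trans (T_le _).
have -> : T (\sum_(n < K) b n *: u n) =
    \sum_(n < K) (b n / d (x n) (z n)) *: (f (x n) - f (z n)).
  rewrite linear_sum; apply: eq_bigr => n _.
  by rewrite /u scalerA linearZ linearB -f0B -!Tf.
apply: le_trans (f_lower K (fun n => b n / d (x n) (z n))); rewrite mulr_sumr.
apply: ler_sum => n _.
rewrite normrM powRM// normfV (gtr0_norm (d_xz n)).
rewrite [leLHS]mulrC -mulrA ler_wpM2l ?powR_ge0// mulrA ler_pM2r ?invr_gt0//.
have d1 : (d (x n) (z n))^-1 `^ p * rho (x n) (z n) = 1.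
  by rewrite -powRM ?invr_ge0// mulVf ?powR1// gt_eqF.
by rewrite -[leLHS]mulr1 -d1 mulrCA ler_wpM2l ?powR_ge0.
Qed.
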